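(* Let $\ell>0$ and let a user's beliefs about an error map on a task space $\mathcal{Z}$ be given by a Gaussian-process prior with kernel $k$ satisfying $k(x,x)\le 1$ and $k(x,x')=0$ whenever $\|x-x'\|>\ell$. Suppose that scaling the model weakly decreases local error pointwise: the post-update error map $V_1$ and the pre-update error map $V_0$ satisfy $V_1(x)\le V_0(x)$ for all $x\in\mathcal{Z}$. Fix a belief state $\mathcal{F}_t$ with data locations $\mathcal{A}_t=\{x_1,\dots,x_t\}$ and perceived safe set $S_t$. Consider two post-update error maps $V_1$ and $\tilde V_1$ satisfying $\tilde V_1(x)\le V_1(x)$ for all $x\in\mathcal{Z}$ and $$\tilde V_1(x)=V_1(x)\quad\text{for all }x\in N_\ell(\mathcal{A}_t).$$ Suppose the user carries over $\mathcal{F}_t$ as their prior at the update and, after the update, observes feedback only at locations they delegate (i.e. only at points in $S_s$ for $s\ge t$). Define the stopping time $$\tau=\inf\{s>t:\ x_s\notin N_\ell(\mathcal{A}_t)\},$$ with the convention $\inf\emptyset=\infty$. Then the induced sequences of posteriors and delegation policies are identical under $V_1$ and $\tilde V_1$ on the event $\{\tau=\infty\}$, and more generally are identical up to time $\tau$ on every sample path. In particular, any improvement in $\tilde V_1$ relative to $V_1$ that is supported outside $N_\ell(\mathcal{A}_t)$ has zero marginal effect on outcomes until the user first samples outside that neighbourhood, and has zero marginal effect forever if $\tau=\infty$.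
   Context: $\mathcal{Z}$ is the space of tasks, with distance $\|x-x'\|$; an error map is a function $V:\mathcal{Z}\to\mathbb{R}_+$ giving the model's local mean-squared error. Using the AI at task $x$ gives expected utility $1-V(x)/q$, with $q>0$ a stakes parameter; not using it gives $0$. Neighbourhood: $N_\ell(\mathcal{A}_t)=\{x\in\mathcal{Z}:\min_{a\in\mathcal{A}_t}\|x-a\|\le\ell\}$. Feedback: when the user evaluates the model at $x_s$ they observe $y_s=V(x_s)+\eta_s$, where $V$ is the error map in force and the $\eta_s$ are i.i.d. $\mathcal{N}(0,\sigma_n^2)$ conditional on the locations and $V$. Beliefs: the user models the error map as a sample from $\mathcal{GP}(0,k)$ (this model may be misspecified). $\mathcal{F}_s$ is the sigma-algebra generated by the history of $s$ observations; $\mu_s(x)$ and $s_s^2(x)$ are the Gaussian-process posterior mean and variance of $V(x)$ given $\mathcal{F}_s$. Delegation: for fixed $\beta>0$, $\hat V_s(x)=\mu_s(x)+\sqrt{\beta}\,s_s(x)$; the perceived safe set is $S_s=\{x\in\mathcal{Z}:\hat V_s(x)\le q\}$ and the delegation policy is $\pi_s(x)=\mathbf{1}\{x\in S_s\}$. *)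

(* Defs.v *)
(* MathComp / MathComp-Analysis. *)
From HB Require Import structures.
From mathcomp Require Import all_boot all_order all_algebra.
From mathcomp Require Import all_classical all_reals all_analysis.
Set Implicit Arguments.
Unset Strict Implicit.
Unset Printing Implicit Defensive.
Import Order.TTheory GRing.Theory Num.Theory.
Import numFieldNormedType.Exports.

Local Open Scope classical_set_scope.
Local Open Scope ring_scope.

(* A realised history: the list of (location, observation) pairs, oldest
   first.  It is a value of the data generating F_s. *)
Definition history (R : realType) (X : normedModType R) := seq (X * R).

Definition locations (R : realType) (X : normedModType R)
  (h : history X) : seq X := map fst h.

(* N_ell(A) inside the task space Z; the minimum over no location is +oo, so
   the neighbourhood of an empty data set is empty. *)
Definition neighbourhood (R : realType) (X : normedModType R)
  (Z : set X) (ell : R) (A : seq X) : set X :=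
  [set x | Z x /\ (\big[Order.min/+oo]_(a <- A) (`|x - a|)%:E <= ell%:E)%E].

(* Covariance kernels on Z: symmetric and positive semidefinite. *)
Definition gp_kernel (R : realType) (X : normedModType R)
  (Z : set X) (k : X -> X -> R) : Prop :=
  (forall x x', Z x -> Z x' -> k x x' = k x' x) /\
  (forall (n : nat) (p : 'I_n -> X) (c : 'I_n -> R), (forall i, Z (p i)) ->
     0 <= \sum_(i < n) \sum_(j < n) c i * c j * k (p i) (p j)).

(* Posterior of f ~ GP(0, k) given y_i = f(x_i) + N(0, sigma^2) noise, with
   K = (k(x_i, x_j))_ij and k_x = (k(x, x_i))_i :
     mean        k_x (K + sigma^2 I)^-1 y
     covariance  k(x, x') - k_x (K + sigma^2 I)^-1 k_x'^T.
   The mean and covariance functions determine the posterior, which is again a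
   Gaussian process. *)
Section gaussian_process_posterior.
Context (R : realType) (X : normedModType R).
Implicit Types (k : X -> X -> R) (sigma : R) (h : history X) (x : X).

Definition noisy_gram k sigma h : 'M[R]_(size h) :=
  \matrix_(i, j) k (tnth (in_tuple h) i).1 (tnth (in_tuple h) j).1
    + (sigma ^+ 2)%:M.

Definition cross_cov k h x : 'rV[R]_(size h) :=
  \row_i k x (tnth (in_tuple h) i).1.

Definition obs_vector h : 'cV[R]_(size h) :=
  \col_i (tnth (in_tuple h) i).2.

Definition post_mean k sigma h x : R :=
  (cross_cov k h x *m invmx (noisy_gram k sigma h) *m obs_vector h) 0 0.

Definition post_cov k sigma h x x' : R :=
  k x x' - (cross_cov k h x *m invmx (noisy_gram k sigma h)
              *m (cross_cov k h x')^T) 0 0.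

Definition post_var k sigma h x : R := post_cov k sigma h x x.

Definition posterior k sigma h : (X -> R) * (X -> X -> R) :=
  (post_mean k sigma h, post_cov k sigma h).

End gaussian_process_posterior.

Definition perceived_error (R : realType) (X : normedModType R)
  (k : X -> X -> R) (sigma beta : R) (h : history X) (x : X) : R :=
  post_mean k sigma h x + Num.sqrt beta * Num.sqrt (post_var k sigma h x).

Definition safe_set (R : realType) (X : normedModType R) (Z : set X)
  (k : X -> X -> R) (sigma beta q : R) (h : history X) : set X :=
  [set x | Z x /\ perceived_error k sigma beta h x <= q].

Definition policy (R : realType) (X : normedModType R) (Z : set X)
  (k : X -> X -> R) (sigma beta q : R) (h : history X) : X -> R :=
  \1_(safe_set Z k sigma beta q h).

(* How the user picks the location of observation s.+1: a function of the date
   s, of the history up to s, and of a seed u collecting everything else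
   (arriving tasks, tie-breaking).  It does not see the error map.  [None]
   means that no feedback is obtained at that date, as must be the case when
   the safe set is empty. *)
Definition sampling_rule (R : realType) (X : normedModType R) (T : Type) :=
  nat -> history X -> T -> option X.

Definition samples_only_delegated (R : realType) (X : normedModType R)
  (T : Type) (Z : set X) (k : X -> X -> R) (sigma beta q : R) (t : nat)
  (rule : sampling_rule X T) : Prop :=
  forall s h u x, (t <= s)%N -> rule s h u = Some x ->
    safe_set Z k sigma beta q h x.

(* The sample path after the update at date t, starting from the carried-over
   data D, with error map V, noise realisation e and seed realisation u. *)
Section sample_path.
Context (R : realType) (X : normedModType R) (T : Type).
Variables (t : nat) (D : history X) (rule : sampling_rule X T).
Variables (V : X -> R) (e : nat -> R) (u : T).

(* The history at date s; dates before t are irrelevant and get D. *)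
Fixpoint history_at (s : nat) : history X :=
  if s is r.+1 then
    if (r < t)%N then D
    else let h := history_at r in
         if rule r h u is Some x then rcons h (x, V x + e r.+1) else h
  else D.

(* x_s and y_s for s > t. *)
Definition location_at (s : nat) : option X :=
  if s is r.+1 then rule r (history_at r) u else None.

Definition observation_at (s : nat) : option R :=
  omap (fun x => V x + e s) (location_at s).

(* inf {s > t : x_s is defined and x_s is not in N}, equal to +oo when there
   is no such s. *)
Definition exit_time (N : set X) : \bar R :=
  ereal_inf [set s%:R%:E | s in
    [set s | (t < s)%N /\ exists2 x, location_at s = Some x & ~ N x]].

(* Expected utility realised at x_s under the policy in force when the task is
   delegated, i.e. the one based on the history up to s.-1. *)
Definition payoff_at (Z : set X) (k : X -> X -> R) (sigma beta q : R)
  (s : nat) : R :=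
  if location_at s is Some x then
    policy Z k sigma beta q (history_at s.-1) x * (1 - V x / q)
  else 0.

End sample_path.

(* Post-update noise: the eta_s (s > t) are N(0, sigma^2), mutually independent
   and jointly independent of the seed U.  Since x_s is a function of U and of
   the eta_r with r < s, this is the i.i.d. noise conditional on locations. *)
Definition gaussian_noise (R : realType) (dO dT : measure_display)
  (Omega : measurableType dO) (T : measurableType dT) (P : probability Omega R)
  (sigma : R) (t : nat) (eta : nat -> {RV P >-> R}) (U : {RV P >-> T}) : Prop :=
  (forall s (B : set R), (t < s)%N -> measurable B ->
     P (eta s @^-1` B) = normal_prob 0 sigma B) /\
  (forall (J : seq nat) (B : nat -> set R) (C : set T),
     uniq J -> (forall j, j \in J -> (t < j)%N) ->
     (forall j, measurable (B j)) -> measurable C ->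
     P ((U @^-1` C) `&` \bigcap_(j in [set` J]) (eta j @^-1` B j)) =
     (P (U @^-1` C) * \prod_(j <- J) P (eta j @^-1` B j))%E).

(* Main.v *)
(* The user sees the error map only through the observations.  Before the first
   sample outside the neighbourhood every observation is taken where the two
   maps agree, so by induction on the date both scenarios generate the same
   history, and the next location is a function of that history.  Hence a
   first exit in one scenario is also an exit in the other. *)
Require Import Defs.
From HB Require Import structures.
From mathcomp Require Import all_boot all_order all_algebra.
From mathcomp Require Import all_classical all_reals all_analysis.
Import Order.TTheory GRing.Theory Num.Theory.
Import numFieldNormedType.Exports.
Local Open Scope classical_set_scope.
Local Open Scope ring_scope.

Set Implicit Arguments.
Unset Strict Implicit.

Section coupled_paths.
Context (R : realType) (X : normedModType R) (T : Type).
Context (t : nat) (D : history X) (rule : sampling_rule X T).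
Context (e : nat -> R) (u : T) (N : set X).
Implicit Types (V : X -> R) (s r : nat).

Let hist V s := history_at t D rule V e u s.
Let loc V s := location_at t D rule V e u s.
Let obs V s := observation_at t D rule V e u s.
Let tau V := exit_time t D rule V e u N.

(** Form of [s < tau V] without the infimum, suited to induction on the date. *)
Definition stays_until V s : Prop :=
  forall r x, (t < r <= s)%N -> loc V r = Some x -> N x.

Lemma stays_untilW V r s :
  (r <= s)%N -> stays_until V s -> stays_until V r.
Proof.
move=> rs Vs i x /andP[ti ir]; apply: Vs.
by rewrite ti (leq_trans ir rs).
Qed.

Lemma lt_exit_time_stays V s : (s%:R%:E < tau V)%E -> stays_until V s.
Proof.
move=> s_tau r x /andP[tr rs] locr; apply: contrapT => NNx.
have : (tau V <= r%:R%:E)%E.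
  by apply: ereal_inf_lbound; exists r => //; split => //; exists x.
apply/negP; rewrite -ltNge; apply: le_lt_trans s_tau.
by rewrite lee_fin ler_nat.
Qed.

(** Allows [s.+1] to be the exit date itself: the dates strictly before it are still inside [N]. *)
Lemma le_exit_time_stays V s : (s.+1%:R%:E <= tau V)%E -> stays_until V s.
Proof.
move=> s_tau; apply: lt_exit_time_stays; apply: lt_le_trans s_tau.
by rewrite lte_fin ltr_nat.
Qed.

Section agreement.
Context (V V' : X -> R) (VV' : forall x, N x -> V' x = V x).

(** Staying is assumed under [V] alone; equal histories lead to the same next location, so [V'] is
    read at the same points of [N]. *)
Lemma eq_history_at s : stays_until V s -> hist V' s = hist V s.
Proof.
elim: s => [//|s IHs] Vs; rewrite /hist /=.
(* For [s < t] both histories are still [D]. *)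
case: ltnP => // ts.
have -> : history_at t D rule V' e u s = history_at t D rule V e u s.
  by apply/IHs/stays_untilW/Vs.
case E: (rule _ _ _) => [x|] //.
by rewrite VV' //; apply: (Vs s.+1 x) => //; rewrite ltnS ts leqnn.
Qed.

(** The location at [s] is chosen before its own observation, so [s.-1] suffices and the location
    may itself lie outside [N]. *)
Lemma eq_location_at s : stays_until V s.-1 -> loc V' s = loc V s.
Proof.
case: s => [//|s] Vs; rewrite /loc /=.
by rewrite [history_at _ _ _ V' _ _ _]eq_history_at.
Qed.

Lemma eq_observation_at s :
  (t < s)%N -> stays_until V s -> obs V' s = obs V s.
Proof.
move=> ts Vs; rewrite /obs /observation_at.
rewrite [location_at _ _ _ V' _ _ _]eq_location_at; last first.
  exact: stays_untilW (leq_pred s) Vs.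
rewrite /loc; case E: (location_at _ _ _ _ _ _ _) => [x|] //=.
by rewrite VV' //; apply: (Vs s x) => //; rewrite ts leqnn.
Qed.

(** The policy in force only needs the history at [s.-1]; the error at the location also needs that
    location to be in [N]. *)
Lemma eq_payoff_at (Z : set X) (k : X -> X -> R) (sigma beta q : R) s :
  (t < s)%N -> stays_until V s ->
  payoff_at t D rule V' e u Z k sigma beta q s =
  payoff_at t D rule V e u Z k sigma beta q s.
Proof.
move=> ts Vs; have Vs1 := stays_untilW (leq_pred s) Vs.
rewrite /payoff_at [location_at _ _ _ V' _ _ _]eq_location_at //.
rewrite [history_at _ _ _ V' _ _ _]eq_history_at // /hist /loc.
case E: (location_at _ _ _ _ _ _ _) => [x|] //.
by rewrite VV' //; apply: (Vs s x) => //; rewrite ts leqnn.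
Qed.

(** An exit under [V'] before [tau V] would occur at the same location under [V], where the path is
    still inside [N]. *)
Lemma le_exit_time : (tau V <= tau V')%E.
Proof.
apply: le_ereal_inf_tmp => _ [s [ts [x locs NNx]] <-].
rewrite leNgt; apply/negP => /lt_exit_time_stays Vs.
apply/NNx/(Vs s); first by rewrite ts leqnn.
rewrite -eq_location_at //; exact: stays_untilW (leq_pred s) Vs.
Qed.

End agreement.

Lemma eq_exit_time V V' : (forall x, N x -> V' x = V x) -> tau V' = tau V.
Proof.
(* Agreement on [N] is symmetric in the two maps, so the inequality applies both ways. *)
move=> VV'; apply/eqP; rewrite eq_le !le_exit_time // => x Nx.
by rewrite VV'.
Qed.

End coupled_paths.

Unset Implicit Arguments.
Set Strict Implicit.

Theorem proposition14
  (R : realType) (X : normedModType R) (Z : set X)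
  (ell q beta sigma : R) (k : X -> X -> R)
  (hell : 0 < ell) (hq : 0 < q) (hbeta : 0 < beta) (hsigma : 0 < sigma)
  (hk : gp_kernel Z k)
  (hk1 : forall x, Z x -> k x x <= 1)
  (hk0 : forall x x', Z x -> Z x' -> ell < `|x - x'| -> k x x' = 0)
  (* error maps before the update and, in two scenarios, after it *)
  (V0 V1 V1' : X -> R)
  (hV0 : forall x, Z x -> 0 <= V0 x)
  (hV1 : forall x, Z x -> 0 <= V1 x)
  (hV1' : forall x, Z x -> 0 <= V1' x)
  (hV10 : forall x, Z x -> V1 x <= V0 x)
  (* belief state at the update: t locations in Z and observations
     y_i = V0 x_i + e0_i *)
  (t : nat) (D : t.-tuple (X * R)) (e0 : 'I_t -> R)
  (hDZ : forall i, Z (tnth D i).1)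
  (hDV0 : forall i, (tnth D i).2 = V0 (tnth D i).1 + e0 i)
  (hV1'1 : forall x, Z x -> V1' x <= V1 x)
  (hV1'N : forall x, neighbourhood Z ell (locations D) x -> V1' x = V1 x)
  (* post-update noise and sampling, common to the two scenarios *)
  (dO dT : measure_display) (Omega : measurableType dO)
  (T : measurableType dT) (P : probability Omega R)
  (eta : nat -> {RV P >-> R}) (U : {RV P >-> T})
  (hnoise : gaussian_noise sigma t eta U)
  (rule : sampling_rule X T)
  (hrule : samples_only_delegated Z k sigma beta q t rule) :
  let N := neighbourhood Z ell (locations D) in
  let hist V w := history_at t D rule V (fun s => eta s w) (U w) in
  let loc V w := location_at t D rule V (fun s => eta s w) (U w) in
  let obs V w := observation_at t D rule V (fun s => eta s w) (U w) in
  let payoff V w :=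
    payoff_at t D rule V (fun s => eta s w) (U w) Z k sigma beta q in
  let tau V w := exit_time t D rule V (fun s => eta s w) (U w) N in
  let post V w s := posterior k sigma (hist V w s) in
  let pi V w s := policy Z k sigma beta q (hist V w s) in
  (* tau does not depend on the scenario *)
  (forall w, tau V1' w = tau V1 w) /\
  (* on {tau = oo} posteriors and policies agree at all dates *)
  (forall w, tau V1 w = +oo%E -> forall s, (t <= s)%N ->
     post V1' w s = post V1 w s /\ pi V1' w s = pi V1 w s) /\
  (* on every path they agree until the observation of date tau comes in *)
  (forall w s, (t <= s)%N -> (s%:R%:E < tau V1 w)%E ->
     post V1' w s = post V1 w s /\ pi V1' w s = pi V1 w s) /\
  (* locations agree through date tau *)
  (forall w s, (t < s)%N -> (s%:R%:E <= tau V1 w)%E ->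
     loc V1' w s = loc V1 w s) /\
  (* outcomes agree before tau, hence forever when tau = oo *)
  (forall w s, (t < s)%N -> (s%:R%:E < tau V1 w)%E ->
     obs V1' w s = obs V1 w s /\ payoff V1' w s = payoff V1 w s) /\
  (forall w, tau V1 w = +oo%E -> forall s, (t < s)%N ->
     loc V1' w s = loc V1 w s /\ obs V1' w s = obs V1 w s /\
     payoff V1' w s = payoff V1 w s).
Proof.
move=> N hist loc obs payoff tau post pi.
have before w s : (s%:R%:E < tau V1 w)%E ->
    stays_until t D rule (fun s => eta s w) (U w) N V1 s.
  exact: lt_exit_time_stays.
have tau_oo w s : tau V1 w = +oo%E -> (s%:R%:E < tau V1 w)%E.
  by move=> ->; exact: ltry.
have beliefs w s : (s%:R%:E < tau V1 w)%E ->
    post V1' w s = post V1 w s /\ pi V1' w s = pi V1 w s.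
  by move=> /before Vs; rewrite /post /pi /hist (eq_history_at hV1'N Vs).
have locations w s : (t < s)%N -> (s%:R%:E <= tau V1 w)%E ->
    loc V1' w s = loc V1 w s.
  (* The date is positive, and its predecessor lies strictly before [tau] even when the date equals
     [tau]. *)
  case: s => [//|s] _ s_tau; apply: (eq_location_at hV1'N).
  exact: le_exit_time_stays.
have outcomes w s : (t < s)%N -> (s%:R%:E < tau V1 w)%E ->
    obs V1' w s = obs V1 w s /\ payoff V1' w s = payoff V1 w s.
  move=> ts /before Vs; split; first exact: (eq_observation_at hV1'N).
  exact: (eq_payoff_at hV1'N).
split; first by move=> w; exact: eq_exit_time.
split; first by move=> w w_oo s _; apply/beliefs/tau_oo.
split; first by move=> w s _; exact: beliefs.
split; first exact: locations.
split; first exact: outcomes.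
move=> w w_oo s ts; split; first exact/locations/ltW/tau_oo.
exact/outcomes/tau_oo.
Qed.
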